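(* Let $q\in(0,1/2)$ and let $H\subset\mathbb{N}$ be an infinite set whose complement $\mathbb{N}\setminus H$ is also infinite, and suppose that $1\notin H$ and $2\in H$. Then there is no absolutely summable sequence $(x_n)_{n\ge 1}$ of real numbers such that the set $E(x_n)$ is isometric to $N_q^H$ (both regarded as metric spaces with the usual metric of $\mathbb{R}$).
   Context: $\mathbb{N}=\{1,2,3,\dots\}$. For an absolutely summable sequence $(x_n)$ of real numbers, its achievement set is $E(x_n)=\{\sum_{n=1}^\infty \varepsilon_n x_n : (\varepsilon_n)\in\{0,1\}^{\mathbb{N}}\}$. For $q\in(0,1/2)$, sets $U_n^q$ ($n\ge1$) are defined by the usual Cantor construction: start with the interval $[0,1]$; at the $n$-th step there are $2^{n-1}$ disjoint closed intervals of length $q^{n-1}$, and from each of them one removes the concentric open middle interval of length $q^{n-1}(1-2q)$, leaving $2^n$ closed intervals of length $q^n$. $U_n^q$ denotes the union of the $2^{n-1}$ open intervals removed at the $n$-th step. The geometric Cantor set is $C_q=[0,1]\setminus\bigcup_{n=1}^\infty U_n^q$. For $H\subset\mathbb{N}$ infinite with infinite complement, the regular Cantorval is $N_q^H=[0,1]\setminus\bigcup_{n\in H}U_n^q$. *)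

(* Defs.v *)
From HB Require Import structures.
From mathcomp Require Import all_boot all_order all_algebra.
From mathcomp Require Import all_classical all_reals all_analysis.

Set Implicit Arguments.
Unset Strict Implicit.
Unset Printing Implicit Defensive.

Import Order.TTheory GRing.Theory Num.Theory.
Import numFieldNormedType.Exports.

Local Open Scope classical_set_scope.
Local Open Scope ring_scope.

(* Sequences are indexed from 0: the term written x_n, n >= 1, on paper is
   [x n.-1]. *)
Definition absolutely_summable (R : realType) (x : R^nat) : Prop :=
  cvgn [normed series x].

Definition achievement_set (R : realType) (x : R^nat) : set R :=
  [set s | exists eps : nat -> bool,
     series (fun n => (eps n)%:R * x n) @ \oo --> s].

(* Endpoint pairs of the 2^n closed intervals left after n steps. *)
Fixpoint cantor_stage (R : realType) (q : R) (n : nat) : seq (R * R) :=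
  if n is m.+1 then
    flatten [seq [:: (J.1, J.1 + q ^+ n); (J.2 - q ^+ n, J.2)]
            | J <- cantor_stage q m]
  else [:: (0, 1)].

(* U_n^q for n >= 1: a stage n-1 interval [a, b] has length q^(n-1), so
   ]a + q^n, b - q^n[ is its concentric open subinterval of length
   q^(n-1) (1 - 2q).  The value at n = 0 is the empty interval ]1, 0[. *)
Definition cantor_removed (R : realType) (q : R) (n : nat) : set R :=
  [set y | exists2 J, J \in cantor_stage q n.-1 &
     y \in `]J.1 + q ^+ n, J.2 - q ^+ n[ ].

Definition regular_cantorval (R : realType) (q : R) (H : set nat) : set R :=
  `[0, 1] `\` \bigcup_(n in H) cantor_removed q n.

(* Isometry of A and B as subspaces of the line; the values of f outside A
   play no role, and injectivity on A follows from preservation of distances. *)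
Definition isometric_sets (R : realType) (A B : set R) : Prop :=
  exists f : R -> R,
    (forall x y, A x -> A y -> `|f x - f y| = `|x - y|) /\ f @` A = B.

(* Main.v *)
(* Write s = q^2, N for the Cantorval and E for the achievement set. Up to
   translation E(x) is E(|x|) and, N being symmetric, an isometric copy of N is
   a translate of N, so it suffices to exclude E(y) = N with y >= 0.
   The first gap ]s, q - s[ of N is longer than every gap inside [0, s], hence
   the terms y_i <= s add up to at most s, and exactly to s; the others,
   finitely many, are a_0 <= a_1 <= ... with a_0 = q - s and total 1 - s.
   A point of [q, 1 - q] below D = a_0 + a_1 uses exactly one of these large
   terms, so [q, D[ is covered by the sets a_j + K, where K is the part of N in
   [0, s]. As K contains no interval longer than s (1 - 2 q), this forces so
   many and so large terms a_j that their sum exceeds 1 - s. *)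
Require Import Defs.
From mathcomp Require Import all_boot all_order all_algebra.
From mathcomp Require Import all_classical all_reals all_analysis.
From mathcomp Require Import ring lra.

Set Implicit Arguments.
Unset Strict Implicit.
Unset Printing Implicit Defensive.

Import Order.TTheory GRing.Theory Num.Theory.
Import numFieldNormedType.Exports.

Local Open Scope classical_set_scope.
Local Open Scope ring_scope.

(** * Cantor stages *)

Section CantorStages.
Variables (R : realType) (q : R).
Hypotheses (q_gt0 : 0 < q) (q_lt_half : q < 1 / 2).

Lemma stage_left n (J : R * R) : J \in cantor_stage q n ->
  (J.1, J.1 + q ^+ n.+1) \in cantor_stage q n.+1.
Proof.
by move=> JS; apply/flatten_mapP; exists J => //; rewrite inE eqxx.
Qed.

Lemma stage_right n (J : R * R) : J \in cantor_stage q n ->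
  (J.2 - q ^+ n.+1, J.2) \in cantor_stage q n.+1.
Proof.
by move=> JS; apply/flatten_mapP; exists J => //; rewrite !inE eqxx orbT.
Qed.

Lemma stageS_inv n (J : R * R) : J \in cantor_stage q n.+1 ->
  exists2 I, I \in cantor_stage q n &
    J = (I.1, I.1 + q ^+ n.+1) \/ J = (I.2 - q ^+ n.+1, I.2).
Proof.
move=> /flatten_mapP[I IS]; rewrite !inE => /orP[] /eqP ->; exists I => //.
- by left.
- by right.
Qed.

Lemma stage_length n (J : R * R) : J \in cantor_stage q n ->
  J.2 = J.1 + q ^+ n.
Proof.
case: n => [|n]; first by rewrite inE => /eqP -> /=; rewrite add0r expr0.
by move=> /stageS_inv[I _ [] -> //=]; rewrite subrK.
Qed.

Lemma expq_gt0 n : 0 < q ^+ n.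
Proof. exact: exprn_gt0. Qed.

Lemma expqS_lt n : q ^+ n.+1 + q ^+ n.+1 < q ^+ n.
Proof.
have : 0 < q ^+ n * (1 - 2 * q) by apply: mulr_gt0; [exact: expq_gt0|move: q_lt_half; lra].
by rewrite exprS; lra.
Qed.

Lemma stage_disjoint n (I J : R * R) :
  I \in cantor_stage q n -> J \in cantor_stage q n ->
  [\/ I = J, I.2 < J.1 | J.2 < I.1].
Proof.
elim: n I J => [|n IHn] I J.
  by rewrite !inE => /eqP -> /eqP ->; constructor 1.
move=> /stageS_inv[I' I'S eI] /stageS_inv[J' J'S eJ].
have := stage_length I'S; have := stage_length J'S.
have := expqS_lt n; have := expq_gt0 n.+1.
case: (IHn _ _ I'S J'S) => [e|lt|lt] h1 h2 h3 h4; last 2 first.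
- by case: eI eJ => -> [] -> /=; constructor 2; lra.
- by case: eI eJ => -> [] -> /=; constructor 3; lra.
rewrite -{J' J'S}e in eJ h3 *.
case: eI eJ => -> [] -> /=; first by constructor 1.
- by constructor 2; lra.
- by constructor 3; lra.
- by constructor 1.
Qed.

(** Endpoints survive every step of the construction, so they lie in the Cantorval for every [H];
    they provide points of it in prescribed places. *)
Definition stage_endpoint n (e : R) :=
  exists2 J, J \in cantor_stage q n & e = J.1 \/ e = J.2.

Lemma stage_endpoint_le n m (e : R) : (n <= m)%N ->
  stage_endpoint n e -> stage_endpoint m e.
Proof.
move=> /subnK <-; elim: (m - n)%N => // k IHk /IHk[J JS eJ]; rewrite addSn.
case: eJ => ->.
  by exists (J.1, J.1 + q ^+ (k + n).+1); [exact: stage_left|left].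
by exists (J.2 - q ^+ (k + n).+1, J.2); [exact: stage_right|right].
Qed.

Lemma stage_ancestor n m (J : R * R) : (n <= m)%N ->
  J \in cantor_stage q m ->
  exists2 I, I \in cantor_stage q n & I.1 <= J.1 /\ J.2 <= I.2.
Proof.
move=> /subnK <-; elim: (m - n)%N J => [|k IHk] J; first by exists J.
rewrite addSn => /stageS_inv[I IS eJ].
have [I' I'S [h1 h2]] := IHk _ IS; exists I' => //.
have := stage_length IS; have := expqS_lt (k + n).
have := expq_gt0 (k + n).+1.
by case: eJ => -> /=; split; lra.
Qed.

Lemma stage_itv01 n (J : R * R) : J \in cantor_stage q n ->
  0 <= J.1 /\ J.2 <= 1.
Proof.
by move=> /(@stage_ancestor 0)[]// I; rewrite inE => /eqP ->.
Qed.

(** An endpoint that exists before step [m] is still an endpoint just before it, hence not interior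
    to an interval being cut. A later endpoint lies in an interval left by step [m], which avoids
    the removed middles. *)
Lemma stage_endpoint_not_removed n m (e : R) : (0 < m)%N ->
  stage_endpoint n e -> ~ cantor_removed q m e.
Proof.
case: m => // m _ ne [I /= IS]; rewrite in_itv /= => /andP[e1 e2].
have [nm|mn] := leqP n m.
  have [J JS eJ] := stage_endpoint_le nm ne.
  have := expq_gt0 m.+1; have := expq_gt0 m; have := stage_length JS.
  have := stage_length IS.
  by case: (stage_disjoint IS JS) => [E|lt|lt]; rewrite -?E in eJ *;
    case: eJ => ?; lra.
case: ne => J JS eJ.
have [K KS [h1 h2]] := stage_ancestor mn JS.
have [L LS eK] := stageS_inv KS.
have := stage_length LS; have := stage_length IS; have := stage_length JS.
have := expqS_lt m; have := expq_gt0 m.+1; have := expq_gt0 n.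
by case: (stage_disjoint IS LS) => [E|lt|lt]; rewrite -?E in eK *;
  case: eK eJ h1 h2 => -> /= [] *; lra.
Qed.

(** * Points inside and outside the Cantorval *)

Lemma stage_endpoint_cantorval (H : set nat) n (e : R) :
  H `<=` [set n | (0 < n)%N] -> stage_endpoint n e ->
  regular_cantorval q H e.
Proof.
move=> H_pos ne; split; last first.
  by move=> [m /H_pos m0]; exact: (@stage_endpoint_not_removed n).
case: ne => J JS eJ /=; have [J0 J1] := stage_itv01 JS.
have := stage_length JS; have := expq_gt0 n.
by rewrite in_itv /=; case: eJ => -> *; apply/andP; split; lra.
Qed.

Lemma expq_small (d : R) : 0 < d -> \forall n \near \oo, q ^+ n < d.
Proof.
move=> d0; have q1 : `|q| < 1 by rewrite gtr0_norm//; move: q_lt_half; lra.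
by have /cvgr_lt := @cvg_expr _ _ q1; apply.
Qed.

(** Since [H] is infinite, some late step in [H] cuts the middle out of a tiny interval that has [e]
    as an endpoint. *)
Lemma endpoint_near_gap (H : set nat) n (e x y : R) : infinite_set H ->
  stage_endpoint n e -> x < e -> e < y ->
  exists2 z, x < z < y & ~ regular_cantorval q H z.
Proof.
move=> H_inf ne xe ey.
have d0 : 0 < Num.min (e - x) (y - e) by rewrite lt_min !subr_gt0 xe ey.
have [M _ Msmall] := expq_small d0.
have [m Hm mM] : exists2 m, H m & (maxn M n < m)%N.
  apply: contrapT => nex; apply: H_inf.
  apply: (@sub_finite_set _ _ `I_(maxn M n).+1); last exact: finite_II.
  move=> m Hm /=; rewrite ltnS leqNgt; apply/negP => lt.
  by apply: nex; exists m.
case: m => // m in Hm mM; move: mM; rewrite ltnS geq_max => /andP[Mm nm].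
have := Msmall _ Mm; rewrite lt_min => /andP[d1 d2].
have [J JS eJ] := stage_endpoint_le nm ne.
have len := stage_length JS; have h1 := expqS_lt m; have h2 := expq_gt0 m.
exists ((J.1 + J.2) / 2).
  by case: eJ => ?; apply/andP; split; lra.
by move=> [_]; apply; exists m.+1 => //; exists J => //=;
  rewrite in_itv /=; apply/andP; split; lra.
Qed.

(** []x, y[] is too long for the middle gap of [J], so it contains an inner endpoint or lies in one
    of the two children. The descent stops once the children are shorter than [y - x]. *)
Lemma long_interval_endpoint n (J : R * R) (x y : R) :
  J \in cantor_stage q n -> J.1 <= x -> y <= J.2 ->
  q ^+ n * (1 - 2 * q) < y - x ->
  exists e m, x < e < y /\ stage_endpoint m e.
Proof.
move=> JS Jx yJ lt.
have xy : 0 < y - x.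
  apply: (le_lt_trans _ lt); apply: mulr_ge0; first exact/ltW/expq_gt0.
  by move: q_lt_half; lra.
have [M _ Msmall] := expq_small xy.
have : q ^+ (n + M) < y - x by apply: Msmall; exact: leq_addl.
elim: M n J JS Jx yJ lt {Msmall} => [|M IHM] n J JS Jx yJ lt.
  by rewrite addn0; have := stage_length JS; lra.
rewrite addnS -addSn => ltM.
have JlS := stage_left JS; have JrS := stage_right JS.
have lt' : q ^+ n.+1 * (1 - 2 * q) < y - x.
  have h1 := expqS_lt n; have h2 := expq_gt0 n.+1.
  apply: (le_lt_trans _ lt); apply: ler_wpM2r; move: q_lt_half; lra.
have [y1|y1] := leP y (J.1 + q ^+ n.+1); first exact: IHM JlS _ _ lt' ltM.
have [x1|x1] := ltP x (J.1 + q ^+ n.+1).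
  exists (J.1 + q ^+ n.+1), n.+1; rewrite x1 y1; split=> //.
  by exists (J.1, J.1 + q ^+ n.+1) => //; right.
have [x2|x2] := leP (J.2 - q ^+ n.+1) x; first exact: IHM JrS _ _ lt' ltM.
have [y2|y2] := ltP (J.2 - q ^+ n.+1) y.
  exists (J.2 - q ^+ n.+1), n.+1; rewrite x2 y2; split=> //.
  by exists (J.2 - q ^+ n.+1, J.2) => //; left.
have := stage_length JS; have := exprS q n; nra.
Qed.

(** * Symmetry and coarse shape of the Cantorval *)

Lemma stage_reflect n (J : R * R) : J \in cantor_stage q n ->
  (1 - J.2, 1 - J.1) \in cantor_stage q n.
Proof.
elim: n J => [|n IHn] J.
  by rewrite !inE => /eqP -> /=; rewrite subrr subr0.
move=> /stageS_inv[I /IHn IS [] -> /=].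
- rewrite (_ : 1 - (I.1 + _) = 1 - I.1 - q ^+ n.+1); last by ring.
  exact: stage_right IS.
- rewrite (_ : 1 - (I.2 - _) = 1 - I.2 + q ^+ n.+1); last by ring.
  exact: stage_left IS.
Qed.

Lemma cantorval_reflect (H : set nat) (x : R) :
  regular_cantorval q H x -> regular_cantorval q H (1 - x).
Proof.
move=> [/=]; rewrite in_itv /= => /andP[x0 x1] nx; split.
  by rewrite /= in_itv /=; apply/andP; split; lra.
move=> [m Hm [J /stage_reflect JS]]; rewrite /= in_itv /= => /andP[h1 h2].
apply: nx; exists m => //; exists (1 - J.2, 1 - J.1) => //=.
by rewrite in_itv /=; apply/andP; split; lra.
Qed.

Lemma stage1_left : (0, q) \in cantor_stage q 1.
Proof. by rewrite /= !inE add0r expr1 eqxx. Qed.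

Lemma stage2_left : (0, q ^+ 2) \in cantor_stage q 2.
Proof. by have := stage_left stage1_left; rewrite /= add0r. Qed.

Lemma stage2_middle : (q - q ^+ 2, q) \in cantor_stage q 2.
Proof. exact: stage_right stage1_left. Qed.

Lemma cantorval0 (H : set nat) :
  H `<=` [set n | (0 < n)%N] -> regular_cantorval q H 0.
Proof.
by move=> /(@stage_endpoint_cantorval _ 0); apply; exists (0, 1); [rewrite inE|left].
Qed.

(** Step 1 is skipped, and every later step removes points only from the interiors of [[0, q]] and
    [[1 - q, 1]]. *)
Lemma cantorval_middle (H : set nat) (x : R) :
  H `<=` [set n | (0 < n)%N] -> ~ H 1%N -> q <= x -> x <= 1 - q ->
  regular_cantorval q H x.
Proof.
move=> H_pos H1 qx xq; split.
  by rewrite /= in_itv /=; apply/andP; split; move: q_gt0; lra.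
move=> [[|[|m]] Hm]; [by have := H_pos _ Hm|by []|move=> [J JS]].
rewrite /= in_itv /= => /andP[h1 h2].
have h3 := expq_gt0 m.+2.
have [I IS [hI1 hI2]] := @stage_ancestor 1 m.+1 J isT JS.
by move: IS; rewrite /= !inE expr1 => /orP[] /eqP E; move: hI1 hI2;
  rewrite E /=; lra.
Qed.

Lemma cantorval_gap (H : set nat) (x : R) : H 2%N ->
  regular_cantorval q H x -> q ^+ 2 < x -> q - q ^+ 2 <= x.
Proof.
move=> H2 [_ nx] x1; rewrite leNgt; apply/negP => x2; apply: nx.
exists 2%N => //; exists (0, q); first exact: stage1_left.
by rewrite /= in_itv /= add0r x1 x2.
Qed.

Lemma cantorval_itv01 (H : set nat) (x : R) : regular_cantorval q H x ->
  0 <= x <= 1.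
Proof. by move=> [/=]; rewrite in_itv. Qed.

End CantorStages.

(** * Subsums of a nonnegative series *)

(** Index sets are boolean predicates, which serve directly as the coefficients of
    [achievement_set]. *)
Definition subsum (R : realType) (y : R^nat) (B : pred nat) : R :=
  limn (series (fun n => (B n)%:R * y n)).

Section Subsums.
Variables (R : realType) (y : R^nat).
Hypotheses (y_ge0 : forall n, 0 <= y n) (y_cvg : cvgn (series y)).
Implicit Types B C : pred nat.

Let term_ge0 B n : 0 <= (B n)%:R * y n.
Proof. exact: mulr_ge0. Qed.

Lemma is_cvg_subsum B : cvgn (series (fun n => (B n)%:R * y n)).
Proof.
apply: series_le_cvg y_cvg => // n.
by case: (B n); rewrite ?mul1r ?mul0r.
Qed.

Lemma subsumP B : achievement_set y (subsum y B).
Proof. by exists B; exact: is_cvg_subsum. Qed.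

Lemma achievement_subsum z : achievement_set y z -> exists B, z = subsum y B.
Proof. by move=> [B Bz]; exists B; apply/esym/cvg_lim. Qed.

Lemma le_subsum B C : (forall n, B n -> C n) -> subsum y B <= subsum y C.
Proof.
move=> BC; apply: lim_series_le; [exact: is_cvg_subsum|exact: is_cvg_subsum|].
by move=> n; rewrite ler_wpM2r// ler_nat; have := BC n; case: (B n) => // ->.
Qed.

Lemma eq_subsum B C : B =1 C -> subsum y B = subsum y C.
Proof. by move=> /funext ->. Qed.

Lemma subsum_ge0 B : 0 <= subsum y B.
Proof.
apply: limr_ge; first exact: is_cvg_subsum.
by apply: nearW => n; apply: sumr_ge0.
Qed.

Lemma subsumU B C : (forall n, B n -> ~~ C n) ->
  subsum y [predU B & C] = subsum y B + subsum y C.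
Proof.
move=> BC; rewrite -lim_seriesD; try exact: is_cvg_subsum.
congr (limn (series _)); apply/funext => n /=; rewrite -[RHS]mulrDl -natrD.
congr (_%:R * _); have := BC n; rewrite /= -!topredE /=.
by case: (B n) => /=; case: (C n) => // /(_ isT).
Qed.

Lemma subsum_finite m B : (forall n, B n -> (n < m)%N) ->
  subsum y B = \sum_(0 <= n < m) (B n)%:R * y n.
Proof.
move=> Bm; apply: lim_near_cst => //; exists m => // n /= mn.
rewrite /series /= (@big_cat_nat _ _ _ m)//= -[RHS]addr0; congr (_ + _).
rewrite big_nat_cond big1// => i /andP[/andP[mi _] _]; have := Bm i.
by case: (B i); rewrite ?mul0r// => /(_ isT); rewrite ltnNge mi.
Qed.

Lemma subsum1 i : subsum y (pred1 i) = y i.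
Proof.
rewrite (@subsum_finite i.+1) => [|n /= /eqP ->//].
rewrite big_nat_recr//= eqxx mul1r big_nat big1 ?add0r// => j /andP[_ ji].
by rewrite ltn_eqF// mul0r.
Qed.

Lemma subsumD1 i B : B i -> subsum y B = y i + subsum y [predD1 B & i].
Proof.
move=> Bi; rewrite -subsum1 -subsumU => [|n /= /eqP ->]; last by rewrite /= eqxx.
apply: eq_subsum => n; rewrite !inE /= -!topredE /=.
by have [->|//] := eqVneq n i.
Qed.

Lemma subsumID C B :
  subsum y B = subsum y [predI B & C] + subsum y [predI B & predC C].
Proof.
rewrite -subsumU => [|n /=]; last by rewrite !inE /= -!topredE /= => /andP[_ ->]; rewrite andbF.
by apply: eq_subsum => n; rewrite !inE /= -!topredE /= -andb_orr orbN andbT.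
Qed.

Lemma le_subsum_term i B : B i -> y i <= subsum y B.
Proof. by move=> /subsumD1 ->; rewrite lerDl subsum_ge0. Qed.

(** * Gaps of an achievement set *)

Lemma terms_eventually_lt (g : R) : 0 < g -> exists m, forall n, (m <= n)%N -> y n < g.
Proof.
move=> g0; have y0 := cvg_series_cvg_0 y_cvg.
by have [m _ hm] := cvgr_lt _ y0 _ g0; exists m => n /hm.
Qed.

(* Adding terms smaller than the gap ]s, b[ one at a time cannot cross it. *)
Lemma subsum_no_jump (s b : R) (A Y : pred nat) : s < b ->
  (forall B, subsum y B < b -> subsum y B <= s) ->
  (forall n, Y n -> y n < b - s) -> (forall n, A n -> ~~ Y n) ->
  subsum y A <= s -> subsum y A + subsum y Y <= s.
Proof.
move=> sb gap Yg AY As; rewrite addrC -lerBrDr.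
apply: limr_le; first exact: is_cvg_subsum.
apply: nearW; elim=> [|n IHn].
  by rewrite /series /= big_geq// subr_ge0.
(* Each partial sum over [Y], together with [A], is itself a subsum, so the gap hypothesis applies
   to it. *)
pose Yn m := [pred i | Y i && (i < m)%N].
have YnE m : series (fun n => (Y n)%:R * y n) m = subsum y (Yn m).
  rewrite (@subsum_finite m) => [|i /= /andP[]//].
  by apply: eq_big_nat => i /andP[_ im] /=; rewrite im andbT.
have YnU m : subsum y [predU A & Yn m] = subsum y A + subsum y (Yn m).
  by apply: subsumU => i /AY /= /negbTE ->.
rewrite lerBrDr addrC YnE -YnU; apply: gap.
rewrite YnU -YnE seriesSr YnE.
move: IHn; rewrite YnE; case: (boolP (Y n)) => [/Yg|_]; rewrite ?mul1r ?mul0r; lra.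
Qed.

(* [b] is the right end of a gap [ ]s, b[ ] longer than every gap of the
   achievement set to its left. Among the finite sums of small terms exceeding
   [s] take a least one: replacing its least term [y i] by a slightly smaller
   sum, which only involves terms other than the chosen ones, gives a sum in
   the gap. *)
Lemma first_gap (s b : R) : 0 <= s -> s < b ->
  (forall B, subsum y B < b -> subsum y B <= s) ->
  (forall i, b - s <= y i -> y i <= s ->
     exists B, y i - (b - s) < subsum y B < y i) ->
  subsum y (fun i => y i <= s) <= s.
Proof.
move=> s0 sb gap dense; rewrite leNgt; apply/negP => ltS.
have g0 : 0 < b - s by rewrite subr_gt0.
have [n0 n0P] := terms_eventually_lt g0.
(* The terms at most [s] split into finitely many [mid] ones and the [tiny] ones, which are shorter
   than the gap and cannot jump it. *)
pose mid : pred nat := fun i => (b - s <= y i) && (y i <= s).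
pose tiny : pred nat := fun i => (y i < b - s) && (y i <= s).
have mid_lt i : mid i -> (i < n0)%N.
  move=> /andP[h _]; rewrite ltnNge; apply/negP => /n0P; lra.
have no_tiny (A B : pred nat) : (forall n, A n -> mid n) -> subsum y A <= s ->
    subsum y A + subsum y [predI B & tiny] <= s.
  move=> Am; apply: (@subsum_no_jump s b) => //.
    by move=> n /= /andP[_ /andP[]].
  by move=> n /Am /andP[h _] /=; rewrite /tiny /= negb_and negb_and -leNgt h orbT.
have mid_gt : s < subsum y mid.
  rewrite ltNge; apply/negP => mids.
  have := no_tiny mid predT (fun _ => id) mids.
  move: ltS; rewrite (subsumID mid).
  rewrite (@eq_subsum [predI _ & mid] mid); last first.
    by move=> i; rewrite /= -!topredE /= /mid; case: (y i <= s); rewrite ?andbT ?andbF.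
  rewrite (@eq_subsum [predI _ & predC mid] [predI predT & tiny]); last first.
    move=> i; rewrite /= -!topredE /= /mid /tiny ltNge.
    by case: (y i <= s); rewrite ?andbT ?andbF.
  lra.
(* Sets of [mid] indices are encoded over a finite type, so that a least sum exceeding [s]
   exists. *)
pose dec (S : {ffun 'I_n0 -> bool}) : pred nat :=
  fun n => mid n && [exists i, S i && (i == n :> nat)].
have decK (B : pred nat) : (forall n, B n -> mid n) ->
    subsum y (dec [ffun i : 'I_n0 => B i]) = subsum y B.
  move=> Bm; apply: eq_subsum => n; rewrite /dec.
  apply/andP/idP => [[_ /existsP[i]]|Bn].
    by rewrite ffunE => /andP[Bi /eqP <-].
  split; first exact: Bm.
  apply/existsP; exists (Ordinal (mid_lt _ (Bm _ Bn))).
  by rewrite ffunE /= Bn eqxx.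
pose P S := s < subsum y (dec S).
have P0 : P [ffun i : 'I_n0 => mid i] by rewrite /P decK.
have [S PS Smin] := arg_minP (fun S => subsum y (dec S)) P0.
pose B := dec S.
have Bmid n : B n -> mid n by move=> /andP[].
have minB (C : pred nat) : (forall n, C n -> mid n) -> subsum y C < subsum y B ->
    subsum y C <= s.
  move=> Cm CB; rewrite leNgt; apply/negP => sC.
  by have := Smin [ffun i : 'I_n0 => C i]; rewrite /P decK// => /(_ sC); rewrite leNgt CB.
have [i0 Bi0] : exists i : 'I_n0, B i.
  apply: contrapT => nB; move: PS; rewrite /P ltNge => /negP; apply.
  rewrite (@subsum_finite 0)// ?big_geq// => n Bn.
  by exfalso; apply: nB; exists (Ordinal (mid_lt _ (Bmid _ Bn))).
have [i Bi imin] := @arg_minP _ _ _ i0 (fun i => B i) (fun i : 'I_n0 => y i) Bi0.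
have /andP[gi si] := Bmid _ Bi.
have [C /andP[C1 C2]] := dense _ gi si.
have Clt n : C n -> y n < y i by move=> /le_subsum_term h; exact: le_lt_trans C2.
have CB n : B n -> ~~ C n.
  move=> Bn; apply/negP => /Clt; apply/negP; rewrite -leNgt.
  exact: (imin (Ordinal (mid_lt _ (Bmid _ Bn)))).
have Bb : b <= subsum y B.
  by rewrite leNgt; apply/negP => /gap; rewrite leNgt => /negP; apply.
(* Replacing [y i] by the [mid] part of [C] lowers the sum, so by minimality it is at most [s], and
   the [tiny] part of [C] keeps it there. But [B] without [i] plus all of [C] exceeds
   [b - (b - s) = s]. *)
pose A := [predU [predD1 B & nat_of_ord i] & [predI C & mid]].
have AE : subsum y A = subsum y [predD1 B & nat_of_ord i] + subsum y [predI C & mid].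
  apply: subsumU => n /= /andP[_ /CB /negbTE h].
  by rewrite -!topredE /= h.
have CE : subsum y C = subsum y [predI C & mid] + subsum y [predI C & tiny].
  rewrite (subsumID mid C); congr (_ + _); apply: eq_subsum => n /=.
  rewrite /= /mid /tiny -!topredE /= ltNge.
  case: (boolP (C n)) => //= /Clt h; have -> : y n <= s by lra.
  by rewrite !andbT.
have BE := subsumD1 Bi.
have Amid n : A n -> mid n.
  by move=> /= /orP[/andP[_ /Bmid]//|/andP[_]].
have := no_tiny A C Amid (minB _ Amid _).
have := subsum_ge0 [predI C & tiny].
move=> h1 /(_ _); rewrite AE => h2.
have h3 : subsum y [predD1 B & nat_of_ord i] + subsum y [predI C & mid] < subsum y B by lra.
have := h2 h3; lra.
Qed.

End Subsums.

(* [a j - (q - s)] climbs by at most [s] per step as long as [a j < D], where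
   [D := a 0 + a 1] is the least value not available to single terms; since
   only the last term [a l < D] covers the stretch from [a (l-1) + s] to [D],
   that stretch has length at most [s (1 - 2 q)], hence [l] and [a (l-1)] are
   large, and the terms add up to too much. *)
Lemma staircase_sum (R : realType) (q : R) (K : set R) (a : nat -> R) k :
  0 < q -> q < 1 / 2 -> (1 < k)%N ->
  (forall z, K z -> 0 <= z <= q ^+ 2) ->
  (forall x y, q ^+ 2 * (1 - 2 * q) < y - x ->
     exists2 z, x < z < y & ~ K z) ->
  (forall i j, (i <= j)%N -> (j < k)%N -> a i <= a j) ->
  a 0%N = q - q ^+ 2 ->
  (forall x, q <= x -> x <= 1 - q -> x < a 0%N + a 1%N ->
     exists2 j, (j < k)%N & K (x - a j)) ->
  \sum_(0 <= j < k) a j <> 1 - q ^+ 2.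
Proof.
move=> q0 q2 k1 K01 Kgap mono a0 cover.
set s := q ^+ 2 in K01 Kgap a0 *.
have s0 : 0 < s by exact: exprn_gt0.
have sq : s < q / 2 by rewrite /s expr2; nra.
have a_ge i : (i < k)%N -> q - s <= a i by rewrite -a0; exact: mono.
have tail_ge m : (m <= k)%N -> 0 <= \sum_(m <= j < k) a j.
  move=> mk; rewrite big_nat; apply: sumr_ge0 => j /andP[_ jk].
  by have := a_ge _ jk; lra.
move=> sumE.
have split2 : a 0%N + a 1%N + \sum_(2 <= j < k) a j = 1 - s.
  by rewrite -sumE [RHS]big_ltn 1?ltnW// big_ltn// addrA.
have k2 : (2 < k)%N.
  rewrite ltnNge; apply/negP => k2; move: split2; rewrite big_geq// addr0 => split2.
  (* With only two terms, [a 1 = 1 - q], and [1/2] lies strictly between [a 0 + s = q] and [a 1]. *)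
  have [|||j jk Kj] := cover (1 / 2); [lra|lra|lra|].
  have := K01 _ Kj; case: j jk {Kj} => [|[|j]] jk; [lra|lra|].
  by have := leq_trans jk k2.
(* The third term is at least [q - s]; hence [x < D] alone guarantees [x <= 1 - q] in [cover]. *)
have D_le : a 0%N + a 1%N <= 1 - q.
  have := a_ge _ k2; have := tail_ge 3%N k2.
  by move: split2; rewrite big_ltn//; lra.
set D := a 0%N + a 1%N in cover split2 D_le.
have [l /andP[lk lD] lmax] : exists2 l, (l < k)%N && (a l < D) &
    forall j, (j < k)%N && (a j < D) -> (j <= l)%N.
  have ex : exists j, (j < k)%N && (a j < D).
    by exists 0%N; rewrite ltnW//= /D; have := a_ge _ k1; lra.
  have ub j : (j < k)%N && (a j < D) -> (j <= k)%N by move=> /andP[/ltnW].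
  by case: (ex_maxnP ex ub) => l h1 h2; exists l.
have l1 : (1 <= l)%N by apply: lmax; rewrite k1 /D a0; lra.
have below j x : (j < l)%N -> a j + s < x -> x < D ->
    exists2 i, (j < i <= l)%N & K (x - a i).
  move=> jl xj xD; have jk := ltn_trans jl lk.
  have aj := a_ge _ jk; have [|||i ik Ki] := cover x; [lra|lra|lra|].
  have /andP[K0 K1] := K01 _ Ki; exists i => //; apply/andP; split.
    by rewrite ltnNge; apply/negP => ij; have := mono _ _ ij jk; lra.
  by apply: lmax; rewrite ik /=; lra.
have step j : (j < l)%N -> a j.+1 <= a j + s.
  move=> jl; rewrite leNgt; apply/negP => lt.
  have j1D : a j.+1 < D by apply: le_lt_trans lD; exact: mono.
  have [||i /andP[ji il] /K01] := below j ((a j + s + a j.+1) / 2) jl; [lra|lra|].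
  by have := mono _ _ ji (leq_ltn_trans il lk); lra.
case: l => // l in lk lD l1 lmax below step *.
have top : D - 2 * s + 2 * q * s <= a l.
  rewrite leNgt; apply/negP => lt.
  (* After the shift of index, [a l.+1] is the last term below [D], the only one able to cover []a l
     + s, D[]; a point missing from [K] then stays uncovered. *)
  have [|z /andP[z1 z2] nK] := Kgap (a l + s - a l.+1) (D - a l.+1); first lra.
  have [||i /andP[li il] Ki] := below l (z + a l.+1) (ltnSn l); [lra|lra|].
  have ei : i = l.+1 by apply/eqP; rewrite eqn_leq il li.
  by apply: nK; move: Ki; rewrite ei addrK.
have climb j : (j <= l)%N -> a j.+1 <= a 1%N + j%:R * s.
  elim: j => [|j IHj] jl; first by rewrite mul0r addr0.
  have := step j.+1 jl; have := IHj (ltnW jl); rewrite -natr1; lra.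
(* If [a 1] were the last term below [D], [top] would give [q (1 - q) <= a 1 <= 2 q^2 (1 - q)],
   contradicting [q < 1/2]. *)
case: l => [|l] in lk lD l1 lmax below step top climb *.
  have : 0 < q * ((1 - q) * (1 - 2 * q)) by rewrite !mulr_gt0//; lra.
  by move: top; rewrite /D; have := a_ge _ k1; rewrite a0 /s; lra.
have l_ge := climb l (leqnSn l).
have count : q - s + 2 * q * s <= (l%:R + 2) * s.
  by move: top l_ge; rewrite /D a0; lra.
have low m : (m <= k)%N -> m%:R * (q - s) <= \sum_(0 <= j < m) a j.
  elim: m => [|m IHm] mk; first by rewrite big_geq// mul0r.
  rewrite big_nat_recr//= -natr1; have := IHm (ltnW mk); have := a_ge _ mk; lra.
have sum_ge : l.+1%:R * (q - s) + a l.+1 + a l.+2 <= 1 - s.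
  rewrite -sumE (@big_cat_nat _ _ _ l.+3)//= big_nat_recr//= big_nat_recr//=.
  have := low l.+1 (ltnW (ltnW lk)); have := tail_ge _ lk; lra.
have al2 : a l.+1 <= a l.+2 by exact: mono.
have al1 : 2 * (q - s) - 2 * s + 2 * q * s <= a l.+1.
  by move: top; rewrite /D a0; have := a_ge _ k1; lra.
have cnt : (1 - q) * (1 - 2 * q + 2 * s) <= l.+1%:R * (q - s).
  have -> : l.+1%:R * (q - s) = l.+1%:R * q * (1 - q) by rewrite /s; ring.
  rewrite mulrC; apply: ler_wpM2r; first lra.
  rewrite -(ler_pM2r q0); move: count; rewrite -natr1 /s; lra.
(* The summand [4 q (1 - q)^2] is twice the bound in [al1], one copy for each of [a l.+1] and
   [a l.+2]. Cancelling [1 - q] leaves [q <= 2 s], against [sq]. *)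
have : (1 - q) * (1 - 2 * q + 2 * s) + 4 * q * (1 - q) * (1 - q) <= (1 - q) * (1 + q).
  by move: sum_ge al2 al1 cnt; rewrite /s; lra.
have -> : (1 - q) * (1 - 2 * q + 2 * s) + 4 * q * (1 - q) * (1 - q) =
  (1 - q) * (1 + 2 * q - 2 * s) by rewrite /s; ring.
rewrite ler_pM2l; last lra.
rewrite /s in sq *; lra.
Qed.

(** * Reduction to nonnegative terms *)

(** For [x n < 0] one has [e |x n| = (1 - e) x n + |x n|]: flipping the choices at negative terms
    shifts the sum by their total absolute value. *)
Lemma achievement_set_abs (R : realType) (x : R^nat) : absolutely_summable x ->
  exists c, forall z,
    achievement_set (fun n => `|x n|) z <-> achievement_set x (z - c).
Proof.
move=> x_cvg; pose neg : pred nat := fun n => x n < 0.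
have y_cvg : cvgn (series (fun n => `|x n|)) by exact: x_cvg.
have negP := @is_cvg_subsum _ _ (fun n => normr_ge0 (x n)) y_cvg neg.
exists (subsum (fun n => `|x n|) neg) => z.
have flip (e : nat -> bool) : series (fun n => (e n)%:R * `|x n|) =
    series (fun n => (e n (+) neg n)%:R * x n) +
    series (fun n => (neg n)%:R * `|x n|).
  rewrite -seriesD; congr series; apply/funext => n.
  rewrite /neg fctE; case: (ltP (x n) 0) => xn.
    by rewrite addbT ltr0_norm//; case: (e n); rewrite /= ?mul1r ?mul0r; lra.
  by rewrite addbF ger0_norm// mul0r addr0.
split=> [[e ez]|[e ez]].
  exists (fun n => e n (+) neg n).
  have -> : series (fun n => (e n (+) neg n)%:R * x n) =
     series (fun n => (e n)%:R * `|x n|) - series (fun n => (neg n)%:R * `|x n|).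
    by rewrite flip addrK.
  exact: cvgB.
exists (fun n => e n (+) neg n); rewrite flip.
have -> : (fun n => (e n (+) neg n (+) neg n)%:R * x n) = (fun n => (e n)%:R * x n).
  by apply/funext => n; rewrite addbK.
by rewrite -[z](subrK (subsum (fun n => `|x n|) neg)); exact: cvgD.
Qed.

(** * Achievement sets and regular Cantorvals *)

(** The distances to the preimages [a] of 0 and [b] of 1 determine [f] on [E]: it is [x - a] or
    [a - x], and the symmetry of the Cantorval absorbs the reflection. *)
Lemma isometric_translate (R : realType) (q : R) (H : set nat) (E : set R) :
  0 < q -> q < 1 / 2 -> H `<=` [set n | (0 < n)%N] ->
  isometric_sets E (regular_cantorval q H) ->
  exists c, forall z, E z <-> regular_cantorval q H (z - c).
Proof.
move=> q0 q2 H_pos [f [iso fE]]; set N := regular_cantorval q H in fE *.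
have N0 : N 0 by exact: cantorval0.
have N1 : N 1 by rewrite -[1]subr0; exact: cantorval_reflect.
have [a Ea fa] : (f @` E) 0 by rewrite fE.
have [b Eb fb] : (f @` E) 1 by rewrite fE.
have Nf x : E x -> N (f x) by move=> Ex; rewrite -fE; exists x.
have dist x : E x -> f x = `|x - a| /\ 1 - f x = `|x - b|.
  move=> Ex; have /andP[f0 f1] := cantorval_itv01 (Nf _ Ex).
  rewrite -(iso x a)// -(iso x b)// fa fb subr0 ger0_norm// distrC ger0_norm//; lra.
have [_] := dist a Ea; rewrite fa subr0.
case: (leP b a) => ba; last first.
  rewrite ltr0_norm ?subr_lt0// => eab.
  have fx x : E x -> f x = x - a.
    move=> /dist[]; case: (leP a x) => xa; first by rewrite (ger0_norm (_ : 0 <= x - a)) ?subr_ge0.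
    by rewrite !ltr0_norm ?subr_lt0//; lra.
  exists a => z; split=> [Ez|]; first by rewrite -fx//; exact: Nf.
  by rewrite -fE => -[x Ex]; rewrite fx// => /addIr <-.
rewrite ger0_norm ?subr_ge0// => eab.
have fx x : E x -> f x = a - x.
  move=> /dist[]; case: (leP x a) => xa; first by rewrite ler0_norm ?subr_le0// opprB.
  by rewrite !gtr0_norm ?subr_gt0//; lra.
exists (a - 1) => z; split=> [Ez|].
  have -> : z - (a - 1) = 1 - (a - z) by ring.
  by apply: cantorval_reflect; rewrite -fx//; exact: Nf.
move=> /cantorval_reflect; have -> : 1 - (z - (a - 1)) = a - z by ring.
by rewrite -/N -fE => -[x Ex]; rewrite fx// => /addrI/oppr_inj <-.
Qed.

Lemma cantorval_not_achievement (R : realType) (q : R) (H : set nat)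
    (y : R^nat) : 0 < q -> q < 1 / 2 ->
  H `<=` [set n | (0 < n)%N] -> infinite_set H -> ~ H 1%N -> H 2%N ->
  (forall n, 0 <= y n) -> cvgn (series y) ->
  achievement_set y <> regular_cantorval q H.
Proof.
move=> q0 q2 H_pos H_inf H1 H2 y0 y_cvg EN.
set N := regular_cantorval q H in EN.
pose s := q ^+ 2; pose b := q - s.
have s0 : 0 < s by exact: exprn_gt0.
have sq : s < q / 2 by rewrite /s expr2; nra.
have sumN B : N (subsum y B) by rewrite -EN; exact: subsumP.
have Nsum z : N z -> exists B, z = subsum y B.
  by rewrite -EN; exact: achievement_subsum.
have Ngap z : N z -> s < z -> b <= z by exact: cantorval_gap.
have endN n e : stage_endpoint q n e -> N e by exact: stage_endpoint_cantorval.
have termN i : N (y i) by rewrite -(subsum1 y i).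
have Ts : subsum y (fun i => y i <= s) <= s.
  apply: (@first_gap _ _ y0 y_cvg s b) => //; [exact: ltW|rewrite /b; lra| |].
    by move=> B Bb; rewrite leNgt; apply/negP => /(Ngap _ (sumN B)); lra.
  move=> i gi si.
  have [||||e [m [ei /endN/Nsum[B eB]]]] :=
    @long_interval_endpoint _ q q0 q2 2 (0, s) (y i - (b - s)) (y i).
  - exact: stage2_left.
  - by rewrite /= subr_ge0.
  - by [].
  (* This product is [(b - s) - s (1 - 2 q)], the excess of the first gap over the longest possible
     gap inside [[0, s]]. *)
  - have : 0 < q * ((1 - q) * (1 - 2 * q)) by rewrite !mulr_gt0//; lra.
    by rewrite /b /s; lra.
  by exists B; rewrite -eB.
have small_sum (B : pred nat) : (forall n, B n -> y n <= s) -> subsum y B <= s.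
  by move=> Bs; apply: le_trans Ts; exact: le_subsum.
have has_big (B : pred nat) : s < subsum y B -> exists2 i, B i & s < y i.
  move=> sB; apply: contrapT => nb; move: sB; rewrite ltNge => /negP; apply.
  by apply: small_sum => n Bn; rewrite leNgt; apply/negP => ?; apply: nb; exists n.
have TE : subsum y (fun i => y i <= s) = s.
  apply/eqP; rewrite eq_le Ts /=.
  have [|B sB] := Nsum s.
    by apply: (endN 2); exists (0, s); [exact: stage2_left|right].
  rewrite {1}sB; apply: le_subsum => // n Bn.
  by rewrite sB; exact: le_subsum_term.
have totE : subsum y predT = 1.
  apply/eqP; rewrite eq_le.
  have /andP[_ -> /=] := cantorval_itv01 (sumN predT).
  have [|B ->] := Nsum 1; last exact: le_subsum.
  by rewrite -[1]subr0; apply: cantorval_reflect; exact: cantorval0.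
(* The endpoint [b] is a sum exceeding [s], so it uses a term above [s]; the gap forces that term to
   be at least [b]. *)
have [i0 yi0] : exists i, y i = b.
  have [|B bB] := Nsum b.
    by apply: (endN 2); exists (b, q); [exact: stage2_middle|left].
  have [|i Bi si] := has_big B; first by rewrite -bB /b; lra.
  exists i; apply/eqP; rewrite eq_le (Ngap _ (termN i) si) andbT bB.
  exact: le_subsum_term.
pose big : pred nat := fun i => s < y i.
have [n0 n0P] := terms_eventually_lt y_cvg s0.
have big_lt i : big i -> (i < n0)%N.
  by move=> bi; rewrite ltnNge; apply/negP => /n0P; rewrite ltNge ltW.
have bigE : subsum y big = 1 - s.
  apply/eqP; rewrite eq_sym subr_eq -totE -TE (subsumID y0 y_cvg big).
  apply/eqP; congr (_ + _); apply: eq_subsum => i //=.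
  by rewrite -!topredE /= -leNgt.
pose le_y := relpre y (<=%O : rel R).
(* The large terms, listed by increasing value, form the staircase [a]. *)
pose idx := sort le_y [seq i <- iota 0 n0 | big i].
have idxE i : (i \in idx) = big i.
  rewrite mem_sort mem_filter mem_iota /= add0n.
  by case: (boolP (big i)) => // /big_lt.
pose a j := y (nth 0%N idx j).
have idx_sum : \sum_(0 <= j < size idx) a j = 1 - s.
  rewrite -bigE (subsum_finite _ big_lt) -(big_nth 0%N predT y) /=.
  rewrite (perm_big [seq i <- iota 0 n0 | big i]) ?perm_sort// big_filter.
  rewrite big_mkcond /index_iota subn0; apply: eq_bigr => i _.
  by case: (big i); rewrite ?mul1r ?mul0r.
have mono i j : (i <= j)%N -> (j < size idx)%N -> a i <= a j.
  move=> ij jk; have sorted_idx : sorted le_y idx.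
    by apply: sort_sorted => u v; exact: le_total.
  apply: (sorted_leq_nth _ _ _ sorted_idx) => //.
  - by move=> u v w; exact: le_trans.
  - by move=> u; exact: lexx.
  - exact: leq_ltn_trans ij jk.
have a_index i : big i -> (index i idx < size idx)%N /\ a (index i idx) = y i.
  by rewrite -idxE => ii; rewrite index_mem ii /a nth_index.
have bi0 : big i0 by rewrite /big yi0 /b; lra.
have [k0 ai0] := a_index _ bi0.
have a0 : a 0%N = b.
  apply/eqP; rewrite eq_le -{1}yi0 -ai0 mono//= Ngap//; first exact: termN.
  by have := mem_nth 0%N (leq_ltn_trans (leq0n _) k0); rewrite idxE.
pose K : set R := [set z | N z /\ 0 <= z <= s].
apply: (@staircase_sum _ q K a (size idx)) => //.
- case: (size idx) k0 idx_sum => [|[|k]]// _.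
  by rewrite big_nat1 a0 /b; lra.
- by move=> z [].
(* If []u, v[] leaves [[0, s]], a point outside is taken; otherwise it contains an endpoint, near
   which points are removed. *)
- move=> u v uv.
  have q3 : 0 < q ^+ 2 * (1 - 2 * q) by apply: mulr_gt0 => //; lra.
  have [u0|u0] := ltP u 0.
    exists ((u + Num.min 0 v) / 2).
      by case: (leP 0 v) => ?; apply/andP; split; lra.
    by case: (leP 0 v) => ? [_ /andP[]]; lra.
  have [v1|v1] := ltP s v.
    exists ((Num.max u s + v) / 2).
      by case: (leP u s) => ?; apply/andP; split; lra.
    by case: (leP u s) => ? [_ /andP[]]; lra.
  have [e [m [/andP[ue ev] me]]] :=
    @long_interval_endpoint _ q q0 q2 2 (0, s) u v (stage2_left q) u0 v1 uv.
  have [z uzv nNz] := endpoint_near_gap q0 q2 H_inf me ue ev.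
  by exists z => // -[].
(* Some large term occurs in [x]; a second one, at another position of [idx], would give
   [x >= a 0 + a 1]. The remaining terms are small, with sum at most [s]. *)
- move=> x qx xq xD.
  have [B xB] := Nsum x (cantorval_middle q0 q2 H_pos H1 qx xq).
  have [|i Bi bi] := has_big B; first by rewrite -xB; lra.
  have [ik ai] := a_index _ bi; exists (index i idx) => //.
  have xi : x - y i = subsum y [predD1 B & i].
    by rewrite xB (subsumD1 y0 y_cvg Bi) addrC addKr.
  rewrite ai xi; split=> //; rewrite subsum_ge0//=; apply: small_sum => n.
  move=> Bn; rewrite leNgt; apply/negP => bn.
  have [nk an] := a_index n bn.
  have : y i + y n <= x.
    by rewrite xB (subsumD1 y0 y_cvg Bi) lerD2l; exact: le_subsum_term.
  have ni : index n idx != index i idx.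
    apply: contraTneq Bn => /(congr1 (nth 0%N idx)).
    by rewrite !nth_index ?idxE// => -> /=; rewrite eqxx.
  rewrite -ai -an; apply/negP; rewrite -ltNge; apply: lt_le_trans xD _.
  case: (posnP (index i idx)) => [i_0|i_gt0].
    by rewrite i_0 lerD2l mono// lt0n -i_0.
  by rewrite addrC lerD// mono.
Qed.

Theorem corollary8 (R : realType) (q : R) (q_gt0 : 0 < q) (q_lt_half : q < 1 / 2)
    (H : set nat) (H_pos : H `<=` [set n | (0 < n)%N])
    (H_inf : infinite_set H)
    (HC_inf : infinite_set ([set n | (0 < n)%N] `\` H))
    (H1 : ~ H 1%N) (H2 : H 2%N) :
  ~ exists x : R^nat, absolutely_summable x /\
      isometric_sets (achievement_set x) (regular_cantorval q H).
Proof.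
move=> [x [x_cvg iso]].
have [c1 E1] := isometric_translate q_gt0 q_lt_half H_pos iso.
have [c2 E2] := achievement_set_abs x_cvg.
pose y n := `|x n|; have y0 n : 0 <= y n by exact: normr_ge0.
have y_cvg : cvgn (series y) by exact: x_cvg.
have EN z : achievement_set y z <-> regular_cantorval q H (z - (c1 + c2)).
  by rewrite E2 E1 -addrA -opprD [c2 + c1]addrC.
(* Both sets have least element 0, so the translation is trivial. *)
have c_le0 : 0 <= - (c1 + c2).
  have /EN : achievement_set y 0.
    rewrite -(_ : subsum y pred0 = 0); first exact: subsumP.
    by rewrite (@subsum_finite _ _ 0)// big_geq.
  by rewrite sub0r => /cantorval_itv01 => /andP[].
have c_ge0 : 0 <= c1 + c2.
  have /achievement_subsum[B ->] : achievement_set y (c1 + c2).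
    by apply/EN; rewrite subrr; exact: cantorval0.
  exact: subsum_ge0.
have c0 : c1 + c2 = 0 by lra.
apply: (cantorval_not_achievement q_gt0 q_lt_half H_pos H_inf H1 H2 y0 y_cvg).
by apply/seteqP; split=> z; have := EN z; rewrite c0 subr0 => -[].
Qed.
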